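(* Consider two network settings $S=(\boldsymbol\mu_i,\Sigma,\gamma_i)_{i\in[n]}$ and $S'=(\boldsymbol\mu_i,\Sigma,\gamma_i')_{i\in[n]}$ which differ only in the risk-aversions of firms $J=\{j:\gamma_j\ne\gamma_j'\}\subseteq[n]$. Then there exists a setting $S^\dagger=(\boldsymbol\mu_i^\dagger,\Sigma,\gamma_i)_{i\in[n]}$ such that $\boldsymbol\mu_i=\boldsymbol\mu_i^\dagger$ for all $i\notin J$ and the stable networks under $S^\dagger$ and $S'$ are identical.
   Context: $[n]=\{1,\dots,n\}$; $\mathbf e_1,\dots,\mathbf e_n$ is the standard basis of $\mathbb R^n$. A network setting $(\boldsymbol\mu_i,\Sigma,\gamma_i)_{i\in[n]}$ consists of vectors $\boldsymbol\mu_i\in\mathbb R^n$, risk aversions $\gamma_i>0$, and a symmetric positive definite covariance $\Sigma\in\mathbb R^{n\times n}$ common to all agents, with all edges allowed. A pair $(W,P)$ of real $n\times n$ matrices is feasible if $W=W^T$ and $P=-P^T$. With $\mathbf w_i$ the $i$-th column of $W$, agent $i$'s utility is $g_i(W,P)=\mathbf w_i^T(\boldsymbol\mu_i-P\mathbf e_i)-\gamma_i\,\mathbf w_i^T\Sigma\mathbf w_i$. A feasible $(W,P)$ is a stable point if for every $i\in[n]$, $g_i(W,P)=\max g_i(W',P)$ over all $W'$ with $(W',P)$ feasible. In this setting the stable point $(W,P)$ exists and is unique, and its $W$ is called the stable network. *)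

(* Defs.v *)
From HB Require Import structures.
From mathcomp Require Import all_boot all_order all_algebra.
From mathcomp Require Import reals.

Set Implicit Arguments.
Unset Strict Implicit.
Unset Printing Implicit Defensive.

Import Order.TTheory GRing.Theory Num.Theory.
Local Open Scope ring_scope.

Definition posdef (R : realType) (n : nat) (A : 'M[R]_n) : Prop :=
  forall x : 'cV[R]_n, x != 0 -> 0 < (x^T *m A *m x) 0 0.

(* All edges are allowed and the covariance is common to all agents. *)
Record network_setting (R : realType) (n : nat) := NetworkSetting {
  mu : 'I_n -> 'cV[R]_n;
  Sigma : 'M[R]_n;
  gamma : 'I_n -> R;
  Sigma_sym : Sigma^T = Sigma;
  Sigma_posdef : posdef Sigma;
  gamma_gt0 : forall i, 0 < gamma i
}.

Definition feasible (R : realType) (n : nat) (WP : 'M[R]_n * 'M[R]_n) : Prop :=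
  WP.1 = WP.1^T /\ WP.2 = - WP.2^T.

(* [delta_mx i 0 : 'cV_n] is the i-th standard basis vector. *)
Definition utility (R : realType) (n : nat) (S : network_setting R n)
    (i : 'I_n) (WP : 'M[R]_n * 'M[R]_n) : R :=
  let w := col i WP.1 in
  (w^T *m (mu S i - WP.2 *m delta_mx i 0)) 0 0
    - gamma S i * (w^T *m Sigma S *m w) 0 0.

Definition stable_point (R : realType) (n : nat) (S : network_setting R n)
    (WP : 'M[R]_n * 'M[R]_n) : Prop :=
  feasible WP /\
  forall (i : 'I_n) (W' : 'M[R]_n),
    feasible (W', WP.2) -> utility S i (W', WP.2) <= utility S i WP.

(* "W is the stable network of S": a definite description, so it includes the
   existence and the uniqueness of the stable point of S. *)
Definition is_the_stable_network (R : realType) (n : nat)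
    (S : network_setting R n) (W : 'M[R]_n) : Prop :=
  exists P : 'M[R]_n, unique (stable_point S) (W, P).

(* Main.v *)
Require Import Defs.
From HB Require Import structures.
From mathcomp Require Import all_boot all_order all_algebra.
From mathcomp Require Import reals.
From mathcomp Require Import ring.

Set Implicit Arguments.
Unset Strict Implicit.
Unset Printing Implicit Defensive.

Import Order.TTheory GRing.Theory Num.Theory.
Local Open Scope ring_scope.

(** With M the matrix of columns [mu i] and G the diagonal matrix of risk
    aversions, strict concavity of the utilities makes stability equivalent to
    the first-order condition [2 Sigma W G = M - P].  Adding the transpose
    eliminates P and leaves the Lyapunov-type equation
    [2 (Sigma W G + G W Sigma) = M + M^T]; its left-hand side is injective in W
    because pairing it with W gives a sum of positive quadratic forms in the
    columns and rows of W.  Hence the stable point exists and is unique.  If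
    (W, P) is the stable point of S', then
    [mu i + 2 (gamma i - gamma' i) Sigma w_i] are means for which the
    first-order condition with the original risk aversions holds at (W, P). *)

Section Quadratic.
Variables (R : realType) (n : nat) (A : 'M[R]_n).
Hypotheses (symA : A^T = A) (posA : posdef A).

Lemma posdef_ge0 (x : 'cV[R]_n) : 0 <= (x^T *m A *m x) 0 0.
Proof.
have [->|/posA/ltW//] := eqVneq x 0.
by rewrite mulmx0 mxE.
Qed.

Lemma posdef_eq0 (x : 'cV[R]_n) : (x^T *m A *m x) 0 0 <= 0 -> x = 0.
Proof.
move=> le0; apply/eqP; apply: contraTT le0 => /posA.
by rewrite -ltNge.
Qed.

Lemma posdef_unitmx : A \in unitmx.
Proof.
rewrite unitmxE unitfE; apply/det0P => -[v v0 vA0].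
have /posA : v^T != 0 by rewrite -(inj_eq trmx_inj) trmxK trmx0.
by rewrite trmxK vA0 mul0mx mxE ltxx.
Qed.

Lemma quadratic_gap (g : R) (w v : 'cV[R]_n) :
  let b := (2 * g) *: (A *m w) in
  (w^T *m b) 0 0 - g * (w^T *m A *m w) 0 0
    - ((v^T *m b) 0 0 - g * (v^T *m A *m v) 0 0)
  = g * ((v - w)^T *m A *m (v - w)) 0 0.
Proof.
move=> b.
have sym : (w^T *m A *m v) 0 0 = (v^T *m A *m w) 0 0.
  have -> : w^T *m A *m v = (v^T *m A *m w)^T.
    by rewrite !trmx_mul trmxK symA mulmxA.
  by rewrite mxE.
have -> : (v - w)^T *m A *m (v - w) =
    v^T *m A *m v - w^T *m A *m v - (v^T *m A *m w - w^T *m A *m w).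
  have -> : (v - w)^T = v^T - w^T by rewrite linearB.
  by rewrite mulmxBr !mulmxBl.
rewrite /b -!scalemxAr !mulmxA.
move: sym; move: (w^T *m A *m v) (v^T *m A *m w) (w^T *m A *m w) (v^T *m A *m v).
by move=> a1 a2 a3 a4 e; rewrite !mxE e; ring.
Qed.

Lemma quadratic_maxP (g : R) (b w : 'cV[R]_n) : 0 < g ->
  (forall v : 'cV[R]_n, (v^T *m b) 0 0 - g * (v^T *m A *m v) 0 0
      <= (w^T *m b) 0 0 - g * (w^T *m A *m w) 0 0)
  <-> (2 * g) *: (A *m w) = b.
Proof.
move=> g0; split=> [maxw|<- v]; last first.
  by rewrite -subr_ge0 quadratic_gap mulr_ge0 ?posdef_ge0 ?ltW.
pose u := (2 * g)^-1 *: (invmx A *m b).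
have ub : (2 * g) *: (A *m u) = b.
  rewrite /u -scalemxAr mulKVmx ?posdef_unitmx // scalerA divff ?scale1r //.
  by rewrite mulf_neq0 ?pnatr_eq0 ?gt_eqF.
move: (maxw u); rewrite -subr_le0 -{1 2}ub quadratic_gap.
rewrite pmulr_rle0 // => /posdef_eq0/subr0_eq -> //.
Qed.

End Quadratic.

Section Lyapunov.
Variables (R : realType) (n : nat) (A : 'M[R]_n) (d : 'rV[R]_n).
Hypotheses (posA : posdef A) (d_gt0 : forall i, 0 < d 0 i).

Definition lyap (X : 'M[R]_n) : 'M[R]_n :=
  A *m X *m diag_mx d + diag_mx d *m X *m A.

Lemma lyap_is_linear : linear lyap.
Proof.
move=> a X Y; rewrite /lyap !(mulmxDr, mulmxDl) -!(scalemxAr, scalemxAl).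
by rewrite scalerDr addrACA.
Qed.

HB.instance Definition _ :=
  GRing.isLinear.Build R 'M[R]_n 'M[R]_n _ lyap lyap_is_linear.

Lemma trace_quadratic (X : 'M[R]_n) :
  \tr (X^T *m A *m X *m diag_mx d) =
  \sum_j d 0 j * ((col j X)^T *m A *m col j X) 0 0.
Proof.
apply: eq_bigr => j _; rewrite mul_mx_diag mxE mulrC; congr (_ * _).
rewrite tr_col -row_mul [LHS]mxE [RHS]mxE; apply: eq_bigr => k _.
by rewrite [row _ _ _ _]mxE [col _ _ _ _]mxE.
Qed.

Lemma lyap_eq0 (X : 'M[R]_n) : lyap X = 0 -> X = 0.
Proof.
move=> X0.
have ge0 Y : 0 <= \tr (Y^T *m A *m Y *m diag_mx d).
  rewrite trace_quadratic sumr_ge0 // => j _.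
  by rewrite mulr_ge0 ?posdef_ge0 ?ltW.
have : \tr (X^T *m A *m X *m diag_mx d)
    + \tr (X^T^T *m A *m X^T *m diag_mx d) = 0.
  rewrite trmxK [X in _ + X]mxtrace_mulC !mulmxA [X in _ + X]mxtrace_mulC.
  by rewrite -mxtraceD -!mulmxA -mulmxDr !mulmxA -/(lyap X) X0 mulmx0 mxtrace0.
move/eqP; rewrite paddr_eq0 // => /andP[/eqP + _].
rewrite trace_quadratic => /eqP; rewrite psumr_eq0; last first.
  by move=> j _; rewrite mulr_ge0 ?posdef_ge0 ?ltW.
move=> /allP q0; apply/matrixP => i j.
have := q0 j; rewrite mem_index_enum mulf_eq0 gt_eqF //= => /(_ isT)/eqP qj.
have /colP/(_ i) : col j X = 0 by apply: (posdef_eq0 posA); rewrite qj.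
by rewrite !mxE.
Qed.

Lemma lyap_inj : injective lyap.
Proof.
by move=> X Y eXY; apply/subr0_eq/lyap_eq0; rewrite linearB /= eXY subrr.
Qed.

Lemma lyap_surj (B : 'M[R]_n) : exists X, lyap X = B.
Proof.
have ker0 : lker (linfun lyap) == 0%VS.
  by apply/lker0P => X Y; rewrite !lfunE; apply: lyap_inj.
exists ((linfun lyap)^-1%VF B).
by rewrite -[lyap _]lfunE lker0_lfunVK.
Qed.

Hypothesis symA : A^T = A.

Lemma lyap_tr (X : 'M[R]_n) : lyap X^T = (lyap X)^T.
Proof.
by rewrite /lyap linearD /= !trmx_mul symA tr_diag_mx !mulmxA addrC.
Qed.

End Lyapunov.

Section Stability.
Variables (R : realType) (n : nat).
Implicit Types (S : network_setting R n) (W P : 'M[R]_n).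

Lemma symmetric_with_col (i : 'I_n) (v : 'cV[R]_n) :
  exists2 W, W = W^T & col i W = v.
Proof.
exists (\matrix_(a, b) if b == i then v a 0 else if a == i then v b 0 else 0).
  by apply/matrixP => a b; rewrite !mxE; do 2!case: eqP => // ->.
by apply/colP => a; rewrite !mxE eqxx.
Qed.

Lemma stable_pointP S W P :
  stable_point S (W, P) <->
  feasible (W, P) /\
  forall i, (2 * gamma S i) *: (Sigma S *m col i W) = mu S i - col i P.
Proof.
split=> -[feasWP opt]; split=> // i.
  apply/quadratic_maxP; [exact: Sigma_sym|exact: Sigma_posdef|exact: gamma_gt0|].
  move=> v; have [W' symW' <-] := symmetric_with_col i v.
  rewrite [col i P]colE; apply: (opt i W'); split=> //.
  by case: feasWP.
move=> W' _; rewrite /utility /= -[P *m _]colE.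
apply: (proj2 (quadratic_maxP (Sigma_sym S) _ _ _ (gamma_gt0 S i)) (opt i)).
exact: Sigma_posdef.
Qed.

Definition mean_mx S : 'M[R]_n := \matrix_(i, j) mu S j i 0.

Definition risk_row S : 'rV[R]_n := \row_j gamma S j.

Lemma risk_row_gt0 S i : 0 < risk_row S 0 i.
Proof. by rewrite mxE gamma_gt0. Qed.

Lemma stable_point_mxP S W P :
  stable_point S (W, P) <->
  feasible (W, P) /\
  2 *: (Sigma S *m W *m diag_mx (risk_row S)) = mean_mx S - P.
Proof.
rewrite stable_pointP; split=> -[feasWP foc]; split=> //.
  apply/matrixP => i j; have /colP/(_ i) := foc j.
  rewrite [col j W]colE mulmxA -colE mul_mx_diag.
  by move: (_ *m W) => Q; rewrite !mxE => <-; ring.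
move=> j; apply/colP => i; have /matrixP/(_ i j) := foc.
rewrite [col j W]colE mulmxA -colE mul_mx_diag.
by move: (_ *m W) => Q; rewrite !mxE => <-; ring.
Qed.

Lemma stable_point_lyap S W P :
  stable_point S (W, P) ->
  2 *: lyap (Sigma S) (risk_row S) W = mean_mx S + (mean_mx S)^T.
Proof.
move=> /stable_point_mxP[[/= symW asymP] foc].
have focT : 2 *: (diag_mx (risk_row S) *m W *m Sigma S) = (mean_mx S)^T + P.
  have := congr1 trmx foc; rewrite linearZ linearB /= !trmx_mul.
  by rewrite tr_diag_mx -symW Sigma_sym mulmxA => ->; rewrite {2}asymP.
by rewrite /lyap scalerDr foc focT addrACA addNr addr0.
Qed.

Lemma stable_point_unique S WP : stable_point S WP -> unique (stable_point S) WP.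
Proof.
case: WP => W P stWP; split=> // -[W' P'] stWP'.
have eW : W = W'.
  apply: (lyap_inj (@Sigma_posdef _ _ S) (risk_row_gt0 S)).
  apply: (@scalerI _ _ (2 : R)); first by rewrite pnatr_eq0.
  by rewrite (stable_point_lyap stWP) (stable_point_lyap stWP').
move: stWP stWP' => /stable_point_mxP[_ foc] /stable_point_mxP[_].
by rewrite -eW foc => /addrI/oppr_inj ->.
Qed.

Lemma stable_point_exists S : exists WP, stable_point S WP.
Proof.
have [W lyapW] := lyap_surj (@Sigma_posdef _ _ S) (risk_row_gt0 S)
  (2^-1 *: (mean_mx S + (mean_mx S)^T)).
have symW : W = W^T.
  apply: (lyap_inj (@Sigma_posdef _ _ S) (risk_row_gt0 S)).
  rewrite lyap_tr ?Sigma_sym // lyapW.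
  by rewrite [(_ *: _)^T]linearZ /= [(_ + _)^T]linearD /= trmxK addrC.
pose B := Sigma S *m W *m diag_mx (risk_row S).
have BT : B + B^T = 2^-1 *: (mean_mx S + (mean_mx S)^T).
  by rewrite -lyapW /lyap /B !trmx_mul tr_diag_mx Sigma_sym -symW mulmxA.
exists (W, mean_mx S - 2 *: B); apply/stable_point_mxP; split; last first.
  by rewrite opprB addrC subrK.
split=> //=; apply/eqP; rewrite -addr_eq0 [(_ - _)^T]linearB /= [(_ *: _)^T]linearZ /=.
by rewrite addrACA -opprD -scalerDr BT scalerA divff ?pnatr_eq0 // scale1r subrr.
Qed.

End Stability.

Theorem theorem8 (R : realType) (n : nat) (S S' : network_setting R n)
    (hmu : forall i : 'I_n, mu S' i = mu S i)
    (hSigma : Sigma S' = Sigma S) :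
  let J : {set 'I_n} := [set j | gamma S j != gamma S' j] in
  exists Sdag : network_setting R n,
    [/\ Sigma Sdag = Sigma S,
        forall i : 'I_n, gamma Sdag i = gamma S i,
        forall i : 'I_n, i \notin J -> mu S i = mu Sdag i &
        exists W : 'M[R]_n,
          is_the_stable_network Sdag W /\ is_the_stable_network S' W].
Proof.
move=> J; have [[W P] stWP] := stable_point_exists S'.
pose mudag i := mu S i + (2 * (gamma S i - gamma S' i)) *: (Sigma S *m col i W).
pose Sdag := NetworkSetting mudag (@Sigma_sym _ _ S) (@Sigma_posdef _ _ S)
  (@gamma_gt0 _ _ S).
exists Sdag; split=> // [i|].
  by rewrite inE negbK => /eqP eg; rewrite /= /mudag eg subrr mulr0 scale0r addr0.
exists W; split; exists P; apply: stable_point_unique => //.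
move: stWP => /stable_pointP[feasWP foc]; apply/stable_pointP; split=> // i.
rewrite /= /mudag addrAC -hmu -foc hSigma -scalerDl.
by congr (_ *: _); ring.
Qed.
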